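(* Let $s\le d$ and $m$ be positive integers. Fix vectors $z,x^*\in\mathbb{R}^d$ with $x^*$ $s$-sparse, and let $A$ be an $m\times d$ random matrix with i.i.d. $N(0,\frac1m)$ entries. Let $H_{s,\eta}$ be the look ahead thresholding operator associated with $A$ and the measurements $y=Ax^*$. Then, whenever $0<\eta<\frac12\cdot\frac{m}{m+d+1}$, there is $\rho<2$ such that $$\mathbb{E}\left[\|H_{s,\eta}(z)-x^*\|_2\right]\le\rho\,\|z-x^*\|_2.$$
   Context: A vector is $s$-sparse if it has at most $s$ nonzero entries. $N(\mu,\sigma^2)$ is the normal distribution with mean $\mu$ and variance $\sigma^2$. The expectation is over the random draw of $A$. Cost: $C(x)=\|y-Ax\|_2^2=\|A(x^*-x)\|_2^2$, so $\nabla C(x)=-2A^*A(x^*-x)$, with $A^*$ the transpose. Look ahead thresholding: for $\Omega\subset\{1,\dots,d\}$ let $P_\Omega$ be the coordinate projection onto the coordinates in $\Omega$ (other entries set to zero). For $z\in\mathbb{R}^d$ set $$f_{\eta,z}(x)=C(z)+\sum_{i=1}^d\left(2\eta\frac{\partial C}{\partial x_i}(z)(x_i-z_i)+(x_i-z_i)^2\right),$$ and let $H_{s,\eta}(z)$ be a minimizer of $f_{\eta,z}(P_\Omega z)$ over vectors $P_\Omega z$ with $|\Omega|=s$ (ties broken arbitrarily). Equivalently, $H_{s,\eta}(z)=P_\Omega z$ where $\Omega$ consists of the indices of the $s$ largest values of $-2\eta z_i\frac{\partial C}{\partial x_i}(z)+z_i^2$. *)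

(* Defs.v *)
From HB Require Import structures.
From mathcomp Require Export all_boot all_order all_algebra.
From mathcomp Require Export all_classical all_reals all_analysis.
Export numFieldNormedType.Exports.

Set Implicit Arguments.
Unset Strict Implicit.
Unset Printing Implicit Defensive.

Import Order.TTheory GRing.Theory Num.Theory.

Local Open Scope classical_set_scope.
Local Open Scope ring_scope.

(* Euclidean norm; the canonical norm `|u| on matrices is the sup norm. *)
Definition l2norm (R : realType) (n : nat) (u : 'cV[R]_n) : R :=
  Num.sqrt (\sum_(i < n) u i 0 ^+ 2).

Definition sparse (R : realType) (d s : nat) (x : 'cV[R]_d) : bool :=
  (#|[pred i | (x i 0 != 0)%R]| <= s)%N.

Definition coord_proj (R : realType) (d : nat) (Omega : {set 'I_d})
    (x : 'cV[R]_d) : 'cV[R]_d :=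
  \col_i (if i \in Omega then x i 0 else 0).

Definition cost (R : realType) (m d : nat) (A : 'M[R]_(m, d)) (y : 'cV[R]_m)
    (x : 'cV[R]_d) : R :=
  l2norm (y - A *m x) ^+ 2.

Definition pderiv (R : realType) (d : nat) (C : 'cV[R]_d -> R) (i : 'I_d)
    (z : 'cV[R]_d) : R :=
  'D_(delta_mx i 0) C z.

Definition lookahead_fun (R : realType) (d : nat) (C : 'cV[R]_d -> R) (eta : R)
    (z x : 'cV[R]_d) : R :=
  C z + \sum_(i < d) (2 * eta * pderiv C i z * (x i 0 - z i 0)
                      + (x i 0 - z i 0) ^+ 2).

(* Ties may be broken arbitrarily, so the operator is only determined up to
   this specification. *)
Definition is_lookahead_thresholding (R : realType) (d s : nat)
    (C : 'cV[R]_d -> R) (eta : R) (H : 'cV[R]_d -> 'cV[R]_d) : Prop :=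
  forall z : 'cV[R]_d, exists Omega : {set 'I_d},
    [/\ #|Omega| = s, H z = coord_proj Omega z
      & forall Omega' : {set 'I_d}, #|Omega'| = s ->
          lookahead_fun C eta z (coord_proj Omega z)
            <= lookahead_fun C eta z (coord_proj Omega' z)].

Definition independent_RVs (disp : measure_display) (T : measurableType disp)
    (R : realType) (P : probability T R) (I : finType)
    (X : I -> {RV P >-> R}) : Prop :=
  forall (J : {set I}) (B : I -> set R),
    (forall i, i \in J -> measurable (B i)) ->
    P (\bigcap_(i in [set` J]) (X i @^-1` B i))
      = (\prod_(i in J) P (X i @^-1` B i))%E.

(* [normal_prob] takes the standard deviation, hence the square root. *)
Definition iid_normal (disp : measure_display) (T : measurableType disp)
    (R : realType) (P : probability T R) (I : finType)
    (X : I -> {RV P >-> R}) (mean var : R) : Prop :=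
  (forall (i : I) (B : set R), measurable B ->
     distribution P (X i) B = normal_prob mean (Num.sqrt var) B)
  /\ independent_RVs X.

Definition random_mx (disp : measure_display) (T : measurableType disp)
    (R : realType) (P : probability T R) (m d : nat)
    (a : 'I_m * 'I_d -> {RV P >-> R}) (t : T) : 'M[R]_(m, d) :=
  \matrix_(i, j) a (i, j) t.

(* Main.v *)
Require Import Defs.
From mathcomp Require Import measurable_realfun zify ring lra.

(** Write [u = z - xstar], [g = A^T A u] and [w = z - 2 eta g].  Up to a
    constant the look ahead functional is the squared distance to [w], so
    [H z] is at least as close to [w] as [P_S z], for any [S] of size [s]
    containing the support of [xstar].  Hence
    |H z - xstar|^2 <= 2 (|P_S z - w|^2 + |w - xstar|^2) =: 2 Q,
    where [Q] is a polynomial of degree 4 in the entries of [A].  Gaussian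
    moments give E g = u and E |g|^2 <= (m + d + 1) / m * |u|^2, whence
    E Q < 2 |u|^2 under the condition on [eta].  Finally
    sqrt (2 Q) <= Q / (2 |u|) + |u| gives a bound on the expected error that is
    strictly below 2 |u|. *)

Set Implicit Arguments.
Unset Strict Implicit.
Unset Printing Implicit Defensive.

Import Order.TTheory GRing.Theory Num.Theory.

Local Open Scope classical_set_scope.
Local Open Scope ring_scope.

(** * Integrals against a pushed forward weight *)

Section weighted_pushforward.
Context d d' (T : measurableType d) (T' : measurableType d') (R : realType).
Variables (mu : {measure set T -> \bar R}) (nu : {measure set T' -> \bar R}).
Variables (X : T -> T') (g : T -> R) (f : T' -> \bar R).
Hypothesis mf : measurable_fun [set: T'] f.

Import HBNNSimple.

(** The hypothesis is the case of indicators; linearity gives simple functions and monotone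
    convergence the rest. It serves twice: with [g] a product of the other independent factors, and
    with [X] the identity and [g] the Gaussian density. *)
Lemma ge0_integral_weighted_pushforward :
  measurable_fun setT X -> measurable_fun setT g -> (forall x, 0 <= g x) ->
  (forall B, measurable B ->
    \int[mu]_(x in X @^-1` B) (g x)%:E = nu B)%E ->
  (forall y, 0 <= f y)%E ->
  (\int[mu]_x ((g x)%:E * f (X x)) = \int[nu]_y f y)%E.
Proof.
move=> mX mg g0 gnu f0.
have mg' : measurable_fun setT (EFin \o g) by exact/measurable_EFinP.
pose h := nnsfun_approx measurableT mf.
have mhX n : measurable_fun setT (fun x => (h n (X x))%:E).
  by apply/measurable_EFinP; exact: measurableT_comp.
have mXP B : measurable B -> measurable (X @^-1` B).
  by move=> mB; rewrite -[_ @^-1` _]setTI; exact: mX.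
transitivity (limn (fun n => \int[mu]_x ((g x)%:E * (h n (X x))%:E))%E).
  rewrite -monotone_convergence//.
  - apply: eq_integral => x _; apply/esym/cvg_lim => //.
    by apply: cvgeZl => //; exact: (cvg_nnsfun_approx measurableT mf).
  - by move=> n; exact: emeasurable_funM.
  - by move=> n x _; rewrite mule_ge0 ?lee_fin.
  - move=> x _ a b ab; rewrite lee_wpmul2l ?lee_fin//.
    exact/lefP/nd_nnsfun_approx.
transitivity (limn (fun n => \int[nu]_y (h n y)%:E)%E); last first.
  rewrite -monotone_convergence//.
  - apply: eq_integral => y _; apply/cvg_lim => //.
    exact: (cvg_nnsfun_approx measurableT mf).
  - by move=> n; exact/measurable_EFinP.
  - by move=> n x _; rewrite lee_fin.
  - by move=> x _ a b ab; rewrite lee_fin; exact/lefP/nd_nnsfun_approx.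
congr (limn _); apply/funext => n.
transitivity (\int[mu]_x (\sum_(y \in range (h n))
    ((y * \1_(h n @^-1` [set y]) (X x))%:E * (g x)%:E)))%E.
  apply: eq_integral => x _; rewrite muleC.
  rewrite -ge0_mule_fsuml => [|y]; last exact: nnfun_muleindic_ge0.
  by rewrite fsumEFin // -(fimfunE _ (X x)).
rewrite ge0_integral_fsum//; last 2 first.
  - move=> y; apply: emeasurable_funM => //; apply/measurable_EFinP.
    by apply: measurable_funM => //; apply: measurableT_comp.
  - by move=> y x _; rewrite mule_ge0 ?lee_fin// -lee_fin nnfun_muleindic_ge0.
transitivity (\int[nu]_x (\sum_(y \in range (h n))
    (y * \1_(h n @^-1` [set y]) x)%:E))%E; last first.
  by apply: eq_integral => x _; rewrite fsumEFin // -(fimfunE _ x).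
rewrite ge0_integral_fsum//; last 2 first.
  - by move=> y; apply/measurable_EFinP; exact: measurable_funM.
  - by move=> y x _; exact: nnfun_muleindic_ge0.
apply: eq_fsbigr => r rhn.
have r0 : 0 <= r by move: rhn; rewrite inE => -[t _ <-].
under [RHS]eq_integral do rewrite EFinM.
rewrite integralZl_indic_nnsfun// integral_indic// setIT.
under eq_integral do rewrite EFinM -muleA.
rewrite ge0_integralZl//; last 2 first.
- apply: emeasurable_funM => //; apply/measurable_EFinP.
  by apply: measurableT_comp.
- by move=> t _; rewrite mule_ge0 ?lee_fin.
rewrite -gnu// [in RHS]integral_mkcond; congr (_ * _)%E.
apply: eq_integral => x _.
by rewrite epatch_indic /= muleC.
Qed.
End weighted_pushforward.

(** * Expectations of products of independent variables *)

(** Integrability and a real value are bundled so that linear combinations of expectations carry no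
    side conditions. *)
Definition has_mean d (T : measurableType d) (R : realType)
    (P : probability T R) (f : T -> R) (e : R) : Prop :=
  P.-integrable setT (EFin \o f) /\ (\int[P]_t (f t)%:E = e%:E)%E.

Section has_mean_theory.
Context d (T : measurableType d) (R : realType) (P : probability T R).
Implicit Types f g : T -> R.

Lemma integrable_has_mean f :
  P.-integrable setT (EFin \o f) -> has_mean P f (fine (\int[P]_t (f t)%:E)%E).
Proof.
move=> fi; split=> //; rewrite fineK//.
exact: (integrable_fin_num measurableT fi).
Qed.

Lemma has_mean_ge0 f e : (forall t, 0 <= f t) -> has_mean P f e -> 0 <= e.
Proof.
move=> f0 [_ fe]; rewrite -lee_fin -fe; apply: integral_ge0 => t _.
by rewrite lee_fin.
Qed.

Lemma has_mean_unique f e1 e2 : has_mean P f e1 -> has_mean P f e2 -> e1 = e2.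
Proof. by move=> [_ h1] [_]; rewrite h1 => -[]. Qed.

Lemma eq_has_mean f g e : f =1 g -> has_mean P f e -> has_mean P g e.
Proof. by move=> /funext ->. Qed.

Lemma has_mean_cst c : has_mean P (fun=> c) c.
Proof.
have h : (\int[P]_t c%:E = c%:E)%E.
  by have := expectation_cst P c; rewrite unlock.
by split=> //; exact: (finite_measure_integrable_cst P c measurableT).
Qed.

Lemma has_meanD f g e1 e2 :
  has_mean P f e1 -> has_mean P g e2 -> has_mean P (fun t => f t + g t) (e1 + e2).
Proof.
move=> [fi fe] [gi ge]; split.
  by rewrite (_ : _ \o _ = (EFin \o f) \+ (EFin \o g))%E//; exact: integrableD.
by under eq_integral do rewrite EFinD; rewrite integralD//= fe ge.
Qed.

Lemma has_meanZ c f e : has_mean P f e -> has_mean P (fun t => c * f t) (c * e).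
Proof.
move=> [fi fe]; split.
  by rewrite (_ : _ \o _ = (fun t => c%:E * (EFin \o f) t)%E)//; exact: integrableZl.
by under eq_integral do rewrite EFinM; rewrite integralZl//= fe.
Qed.

Lemma has_meanB f g e1 e2 :
  has_mean P f e1 -> has_mean P g e2 -> has_mean P (fun t => f t - g t) (e1 - e2).
Proof.
move=> hf /(has_meanZ (-1)) hg; rewrite -(mulN1r e2).
by apply: eq_has_mean (has_meanD hf hg) => t; rewrite mulN1r.
Qed.

Lemma has_mean_sum (I : Type) (s : seq I) (Q : pred I) (f : I -> T -> R)
    (e : I -> R) : (forall i, Q i -> has_mean P (f i) (e i)) ->
  has_mean P (fun t => \sum_(i <- s | Q i) f i t) (\sum_(i <- s | Q i) e i).
Proof.
move=> fe; elim: s => [|i s IH].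
  rewrite big_nil; apply: eq_has_mean (has_mean_cst 0) => t.
  by rewrite big_nil.
rewrite big_cons; case: ifPn => Qi.
  by apply: eq_has_mean (has_meanD (fe i Qi) IH) => t; rewrite big_cons Qi.
by apply: eq_has_mean IH => t; rewrite big_cons (negbTE Qi).
Qed.

Lemma has_mean_indic_preimage (X : {RV P >-> R}) (B : set R) : measurable B ->
  has_mean P (fun t => \1_B (X t)) (fine (P (X @^-1` B))).
Proof.
move=> mB.
have mXB : measurable (X @^-1` B) by rewrite -[_ @^-1` _]setTI; exact: measurable_funP.
split; first exact: integrable_indic.
by rewrite (integral_indic P measurableT mXB) setIT fineK// fin_num_measure.
Qed.

End has_mean_theory.

(** * Multiplicativity of expectation for independent variables *)

Section independent_products.
Context d (T : measurableType d) (R : realType) (P : probability T R).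
Context (I : finType) (X : I -> {RV P >-> R}).
Hypothesis indX : independent_RVs X.
Implicit Types (F : I -> R -> R) (e : I -> R).

Let updE A (f : I -> A) i (b : A) j : j != i ->
  (if j == i then b else f j) = f j.
Proof. by move=> /negbTE ->. Qed.

Let prod_upd (f : I -> R) i b :
  \prod_j (if j == i then b else f j) = b * \prod_(j | j != i) f j.
Proof.
by rewrite (bigD1 i)//= eqxx; congr (_ * _); apply: eq_bigr => j; exact: updE.
Qed.

(* Off [s] the factors are indicators, so that [s = [::]] is the definition of
   independence; the induction frees one factor at a time. *)
Let ge0_has_mean_prod_aux (s : seq I) F e :
  (forall i, i \notin s -> exists2 B, measurable B & F i = \1_B) ->
  (forall i, measurable_fun setT (F i)) -> (forall i y, 0 <= F i y) ->
  (forall i, has_mean P (fun t => F i (X i t)) (e i)) ->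
  (\int[P]_t (\prod_i F i (X i t))%:E = (\prod_i e i)%:E)%E.
Proof.
elim: s F e => [|i s IH] F e FB mF F0 Fe.
  have [B mB FBE] : exists2 B : I -> set R, (forall i, measurable (B i)) &
      forall i, F i = \1_(B i).
    have /choice[B hB] : forall i, exists B, measurable B /\ F i = \1_B.
      by move=> i; have [//|B] := FB i; exists B.
    by exists B => i; have [] := hB i.
  have mXB i : measurable (X i @^-1` B i).
    by rewrite -[_ @^-1` _]setTI; exact: measurable_funP.
  have eE i : (e i)%:E = P (X i @^-1` B i).
    rewrite -(proj2 (Fe i)) FBE.
    by have [_ ->] := has_mean_indic_preimage (X i) (mB i);
      rewrite fineK// fin_num_measure.
  pose A := \bigcap_(i in [set` [set: I]%SET]) (X i @^-1` B i).
  have mA : measurable A by apply: fin_bigcap_measurable => // i _.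
  transitivity (P A).
    have := integral_indic P measurableT mA; rewrite setIT => <-.
    apply: eq_integral => t _; congr EFin; rewrite indicE.
    have [At|nAt] := pselect (A t).
      rewrite mem_set// big1// => i _; rewrite FBE indicE mem_set//.
      by apply: At => /=; rewrite inE.
    rewrite memNset//.
    have [i hi] : exists i, ~ (X i @^-1` B i) t.
      by apply/existsNP => h; apply: nAt => i _; exact: h.
    by rewrite (bigD1 i)//= FBE indicE memNset// mul0r.
  rewrite /A indX//.
  rewrite -prodEFin; apply: eq_big => i; first by rewrite inE.
  by rewrite -eE.
pose G t := \prod_(j | j != i) F j (X j t).
have mFX j : measurable_fun setT (fun t => F j (X j t)) by exact: measurableT_comp.
have mG : measurable_fun setT G.
  rewrite /G; under eq_fun do rewrite -big_filter.
  by apply: measurable_prod => j _; exact: mFX.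
have G0 t : 0 <= G t by exact: prodr_ge0.
have c0 : 0 <= \prod_(j | j != i) e j.
  by apply: prodr_ge0 => j _; apply: has_mean_ge0 (Fe j) => t.
have mXi : measurable_fun [set: T] (X i) by [].
under eq_integral do rewrite (bigD1 i)//= mulrC EFinM.
have mFi : measurable_fun [set: R] (EFin \o F i) by exact/measurable_EFinP.
(* Freeing factor [i]: the weight [G] is the product of the other factors, and the target measure is
   the law of [X i] scaled by the product of their means. The two agree on each [B] by the induction
   hypothesis with factor [i] replaced by [\1_B]. *)
rewrite (@ge0_integral_weighted_pushforward _ _ _ _ _ P
  (mscale (NngNum c0) (distribution P (X i))) (X i) G (EFin \o F i))//.
- have dE := @ge0_integral_distribution _ _ _ _ _ P (X i) (EFin \o F i) mFi
    (fun y => F0 i y).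
  rewrite ge0_integral_mscale//=; last by move=> y _; rewrite lee_fin.
  by rewrite dE (proj2 (Fe i)) -EFinM [in RHS](bigD1 i)//= mulrC.
- move=> B mB.
  have mXB : measurable (X i @^-1` B) by rewrite -[_ @^-1` _]setTI; exact: mXi.
  have := IH (fun j => if j == i then \1_B else F j)
    (fun j => if j == i then fine (P (X i @^-1` B)) else e j).
  rewrite prod_upd mulrC => IHB.
  rewrite [RHS](_ : _ = (\prod_(j | j != i) e j * fine (P (X i @^-1` B)))%:E); last first.
    by rewrite EFinM fineK// fin_num_measure.
  rewrite -IHB.
  + rewrite integral_mkcond; apply: eq_integral => t _.
    rewrite epatch_indic/= -EFinM; congr EFin.
    rewrite (bigD1 i)//= eqxx mulrC; congr (_ * _).
    by apply: eq_bigr => j /negbTE ->.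
  + move=> j js; case: eqP => [_|/eqP ji]; first by exists B.
    by apply: FB; rewrite inE negb_or ji.
  + by move=> j; case: eqP.
  + by move=> j y; case: eqP.
  + move=> j; case: eqP => [->|]; last by move=> _; exact: Fe.
    exact: has_mean_indic_preimage.
- by move=> y; rewrite lee_fin.
Qed.

Lemma independent_has_mean_prod F e :
  (forall i, measurable_fun setT (F i)) ->
  (forall i, has_mean P (fun t => F i (X i t)) (e i)) ->
  has_mean P (fun t => \prod_i F i (X i t)) (\prod_i e i).
Proof.
have ge0 F' e' : (forall i, measurable_fun setT (F' i)) ->
    (forall i y, 0 <= F' i y) ->
    (forall i, has_mean P (fun t => F' i (X i t)) (e' i)) ->
    (\int[P]_t (\prod_i F' i (X i t))%:E = (\prod_i e' i)%:E)%E.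
  move=> mF' F'0; apply: (ge0_has_mean_prod_aux (s := enum I)) => // i.
  by rewrite mem_enum.
(* Only the factors listed in [s] may change sign; the induction splits one of them at a time into
   positive and negative parts and subtracts. *)
suff sgn (s : seq I) F' e' : (forall i y, i \notin s -> 0 <= F' i y) ->
    (forall i, measurable_fun setT (F' i)) ->
    (forall i, has_mean P (fun t => F' i (X i t)) (e' i)) ->
    has_mean P (fun t => \prod_i F' i (X i t)) (\prod_i e' i).
  by move=> mF Fe; apply: (sgn (enum I)) => // i y; rewrite mem_enum.
elim: s F' e' => [|i s IH] F' e' F0 mF' Fe'.
  have intE := ge0 _ _ mF' (fun i y => F0 i y isT) Fe'.
  split=> //; apply/integrableP; split.
    apply/measurable_EFinP; apply: measurable_prod => j _.
    exact: measurableT_comp.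
  rewrite (_ : integral _ _ _ = \int[P]_t (\prod_i F' i (X i t))%:E)%E.
    by rewrite intE ltry.
  apply: eq_integral => t _ /=; rewrite ger0_norm// prodr_ge0// => j _.
  exact: F0.
pose Fp := (F' i)^\+; pose Fn := (F' i)^\-.
have mFp : measurable_fun setT Fp by exact: measurable_funrpos.
have mFn : measurable_fun setT Fn by exact: measurable_funrneg.
have [Fpe Fne] : has_mean P (fun t => Fp (X i t)) (fine (\int[P]_t (Fp (X i t))%:E)%E) /\
    has_mean P (fun t => Fn (X i t)) (fine (\int[P]_t (Fn (X i t))%:E)%E).
  split; apply: integrable_has_mean.
    exact: (integrable_funrpos measurableT (proj1 (Fe' i))).
  exact: (integrable_funrneg measurableT (proj1 (Fe' i))).
have upd (f : R -> R) b : measurable_fun setT f -> (forall y, 0 <= f y) ->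
    has_mean P (fun t => f (X i t)) b ->
    has_mean P (fun t => f (X i t) * \prod_(j | j != i) F' j (X j t))
      (b * \prod_(j | j != i) e' j).
  move=> mf f0 fb; rewrite -prod_upd.
  have /= h := IH (fun j => if j == i then f else F' j)
    (fun j => if j == i then b else e' j).
  apply: eq_has_mean (h _ _ _) => [t|j y js|j|j].
  - rewrite (bigD1 i)//= eqxx; congr (_ * _).
    by apply: eq_bigr => j /negbTE ->.
  - by case: eqP => // /eqP ji; apply: F0; rewrite inE negb_or ji.
  - by case: eqP.
  - by case: eqP => [->|_]; [exact: fb|exact: Fe'].
have hD := has_meanB (upd _ _ mFp (fun y => funrpos_ge0 _ y) Fpe)
  (upd _ _ mFn (fun y => funrneg_ge0 _ y) Fne).
have FE y : F' i y = Fp y - Fn y.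
  by rewrite -{1}(funrposBneg (F' i)).
have eE : e' i = fine (\int[P]_t (Fp (X i t))%:E)%E - fine (\int[P]_t (Fn (X i t))%:E)%E.
  apply: has_mean_unique (Fe' i) _.
  by apply: eq_has_mean (has_meanB Fpe Fne) => t; rewrite FE.
rewrite (bigD1 i)//= eE mulrBl; apply: eq_has_mean hD => t.
by rewrite -mulrBl -FE [RHS](bigD1 i).
Qed.

End independent_products.

(** * Moments of the normal distribution *)

Section gaussian_moments.
Context (R : realType) (s : R).
Hypothesis s_gt0 : 0 < s.
Local Notation mu := (@lebesgue_measure R).
Local Notation phi := (normal_pdf 0 s).

Let s_neq0 : s != 0. Proof. by rewrite gt_eqF. Qed.

Let phiE x : phi x = normal_peak s * expR (- x ^+ 2 / (s ^+ 2 *+ 2)).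
Proof. by rewrite normal_pdfE// /normal_fun subr0. Qed.

Let phiN x : phi (- x) = phi x. Proof. by rewrite !phiE sqrrN. Qed.

Let phi_ge0 x : 0 <= phi x. Proof. exact: normal_pdf_ge0. Qed.

Let cphi : continuous (phi : R -> R).
Proof. exact: continuous_normal_pdf. Qed.

Let is_derive_Nsphi (x : R) :
  is_derive x 1 (fun y : R => - (s ^+ 2 * phi y)) (x * phi x).
Proof.
rewrite phiE (_ : (fun y : R => _) = (fun y : R =>
    - (s ^+ 2 * normal_peak s) * expR (- y ^+ 2 / (s ^+ 2 *+ 2)))); last first.
  by apply/funext => y; rewrite phiE; ring.
by apply: is_derive_eq; rewrite /GRing.scale /=; field.
Qed.

Let is_derive_pow k (x : R) :
  is_derive x 1 (fun y : R => y ^+ k.+1) (k.+1%:R * x ^+ k).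
Proof.
have -> : (fun y : R => y ^+ k.+1) = (@id R) ^+ k.+1.
  by apply/funext => y; rewrite exprfctE.
apply: (is_derive_eq (is_deriveX k.+1 (is_derive_id x 1))).
by rewrite /GRing.scale/= mulr1.
Qed.

Let LR (f df : R -> R) (a b : R) : (forall x : R, is_derive x 1 f (df x)) ->
  derivable_oo_LRcontinuous f a b.
Proof.
move=> h.
have cf : continuous f.
  by move=> x; apply/differentiable_continuous/derivable1_diffP; exact: ex_derive.
split => [x _||]; first exact: ex_derive.
  by apply: cvg_at_right_filter; exact: cf.
by apply: cvg_at_left_filter; exact: cf.
Qed.

Let cpowphi k : continuous (fun x : R => x ^+ k * phi x).
Proof. by move=> x; apply: cvgM; [exact: exprn_continuous|exact: cphi]. Qed.

Let mpowphi k : measurable_fun setT (fun x : R => x ^+ k * phi x).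
Proof. exact: continuous_measurable_fun. Qed.

Let powphi_ge0 k x : ~~ odd k -> 0 <= x ^+ k * phi x.
Proof. by move=> ek; rewrite mulr_ge0// exprn_even_ge0. Qed.

(* Integration by parts, with [x * phi x] the derivative of [- s ^+ 2 * phi]. *)
Let parts k (b : R) : ~~ odd k -> 0 < b ->
  (\int[mu]_(x in `[(- b)%R, b]) (x ^+ k.+2 * phi x)%:E =
   (- (2 * s ^+ 2 * b ^+ k.+1 * phi b))%:E +
   (k.+1%:R * s ^+ 2)%:E * \int[mu]_(x in `[(- b)%R, b]) (x ^+ k * phi x)%:E)%E.
Proof.
move=> ek b0.
have nbb : - b < b by rewrite gtrN.
have c1 : {within `[- b, b], continuous (fun x : R => k.+1%:R * x ^+ k)}.
  apply: continuous_subspaceT => x; apply: cvgM; first exact: cvg_cst.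
  exact: exprn_continuous.
have c2 : {within `[- b, b], continuous (fun x : R => x * phi x)}.
  apply: continuous_subspaceT => x; apply: cvgM; first exact: cvg_id.
  exact: cphi.
have := integration_by_parts nbb c1 (LR (- b) b (is_derive_pow k)) _ c2
  (LR (- b) b is_derive_Nsphi) _.
under eq_integral do rewrite mulrA -exprSr.
move=> ->; first last.
- by move=> x _; rewrite derive1E; apply: derive_val.
- by move=> x _; rewrite derive1E; apply: derive_val.
congr (_ + _)%E.
  congr EFin; rewrite phiN exprNn -signr_odd /= ek; ring.
under eq_integral => x _.
  rewrite (_ : _ * _ = - (k.+1%:R * s ^+ 2 * (x ^+ k * phi x))); last ring.
  rewrite EFinN; over.
rewrite integral_ge0N ?oppeK; last first.
  by move=> x _; rewrite lee_fin mulr_ge0// ?powphi_ge0// mulr_ge0// sqr_ge0.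
under eq_integral do rewrite EFinM.
rewrite ge0_integralZl_EFin//.
- by move=> x _; rewrite lee_fin powphi_ge0.
- by apply/measurable_EFinP; apply: measurable_funTS; exact: mpowphi.
- by rewrite mulr_ge0// sqr_ge0.
Qed.

(** For even [k] the integrand is nonnegative, so monotone convergence applies on the growing
    intervals. The endpoint [n.+1] keeps them nondegenerate, as [parts] requires. *)
Let truncE k : ~~ odd k ->
  (\int[mu]_(x in `[(- n.+1%:R)%R, n.+1%:R%R]) (x ^+ k * phi x)%:E @[n --> \oo] -->
   \int[mu]_x (x ^+ k * phi x)%:E)%E.
Proof.
move=> ek.
have -> : [set: R] = \bigcup_n `[- n.+1%:R, n.+1%:R]%classic.
  apply/esym/seteqP; split=> // x _.
  exists (Num.truncn `|x|) => //=; rewrite in_itv/= -ler_norml.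
  exact/ltW/truncnS_gt.
apply: ge0_nondecreasing_set_cvg_integral => //.
- move=> a b ab; rewrite subsetEset => x /=; rewrite !in_itv/= -!ler_norml => /le_trans; apply.
  by rewrite ler_nat.
- by move=> n; apply/measurable_EFinP; apply: measurable_funTS; exact: mpowphi.
- by move=> n x _; rewrite lee_fin powphi_ge0.
Qed.

(** This is the boundary term of [parts] for [k = 0]. With [y = N ^+ 2 / (2 * s ^+ 2)], the
    inequality [expR y >= 1 + y] bounds [expR (- y)] by [y^-1], so the term is at most [C / N]. *)
Let cvg_tail : (2 * s ^+ 2 * n.+1%:R ^+ 1 * phi n.+1%:R) @[n --> \oo] --> (0 : R).
Proof.
pose C := 4 * s ^+ 4 * normal_peak s.
apply: (@squeeze_cvgr _ _ _ _ (fun=> 0) (fun n => C * harmonic n)).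
- apply: nearW => n; rewrite !mulr_ge0 ?exprn_ge0 ?(ltW s_gt0)//=.
  rewrite phiE mulNr expRN; set N : R := n.+1%:R.
  have N0 : 0 < N by rewrite ltr0n.
  set y := _ ^+ 2 / _.
  have y0 : 0 < y by rewrite divr_gt0 ?exprn_gt0// pmulrn_lgt0// exprn_gt0.
  have yE : y^-1 = 2 * s ^+ 2 / N ^+ 2.
    by rewrite /y; field; rewrite gt_eqF.
  have le_y : (expR y)^-1 <= y^-1.
    rewrite lef_pV2 ?posrE ?expR_gt0// (le_trans _ (expR_ge1Dx y))//.
    by rewrite lerDr.
  apply: (@le_trans _ _ (2 * s ^+ 2 * N ^+ 1 * (normal_peak s * y^-1))).
    rewrite ler_wpM2l ?mulr_ge0 ?exprn_ge0 ?(ltW s_gt0) ?(ltW N0)//.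
    by rewrite ler_wpM2l// normal_peak_ge0.
  rewrite le_eqVlt; apply/orP; left; apply/eqP.
  by rewrite yE /C /=; field; rewrite gt_eqF.
- exact: cvg_cst.
- by rewrite -[X in _ --> X](mulr0 C); apply: cvgM; [exact: cvg_cst|exact: cvg_harmonic].
Qed.

(** Let the interval grow in [parts] with [k = 0]: the boundary term vanishes and the remaining
    integral tends to the total mass 1. *)
Lemma integral_sqr_normal_pdf :
  (\int[mu]_x (x ^+ 2 * phi x)%:E = (s ^+ 2)%:E)%E.
Proof.
have J0 : (\int[mu]_(x in `[(- n.+1%:R)%R, n.+1%:R%R]) (x ^+ 0 * phi x)%:E
    @[n --> \oo] --> 1)%E.
  rewrite -(integral_normal_pdf 0 s); under [X in _ --> X]eq_integral => x _.
    by rewrite -(mul1r (normal_pdf _ _ _)) -(expr0 x); over.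
  exact: (truncE (isT : ~~ odd 0)).
have tail : (- (2 * s ^+ 2 * n.+1%:R ^+ 1 * phi n.+1%:R))%:E @[n --> \oo] --> (0 : R)%:E.
  apply: cvg_EFin; first exact: nearW.
  by have := cvgN cvg_tail; rewrite oppr0; exact.
have sJ0 := cvgeZl (fin_numE _ : (1 * s ^+ 2)%:E \is a fin_num) J0.
have /(_ _ isT) := cvgeD _ tail sJ0.
rewrite add0e mule1 mul1r => sumJ; apply/esym.
rewrite -(cvg_lim _ sumJ)//; apply/esym.
rewrite -(cvg_lim _ (truncE (isT : ~~ odd 2)))//.
by congr (limn _); apply/funext => n; rewrite (@parts 0)// mul1r.
Qed.

(** An upper bound is enough later on, so the boundary term in [parts] is dropped by its sign, and
    the truncated second moment is bounded by the full one. *)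
Lemma integral_pow4_normal_pdf :
  (\int[mu]_x (x ^+ 4 * phi x)%:E <= (3 * s ^+ 4)%:E)%E.
Proof.
have /cvg_lim <- // := truncE (isT : ~~ odd 4).
apply: lime_le; first by apply: cvgP (truncE (isT : ~~ odd 4)).
apply: nearW => n; rewrite (@parts 2)//.
have -> : ((3 * s ^+ 4)%:E = 0 + (3 * s ^+ 2)%:E * (s ^+ 2)%:E)%E.
  by rewrite add0e -EFinM; congr EFin; ring.
apply: leeD.
  by rewrite lee_fin oppr_le0 !mulr_ge0 ?exprn_ge0// ltW.
apply: lee_wpmul2l; first by rewrite lee_fin mulr_ge0// exprn_ge0// ltW.
rewrite -integral_sqr_normal_pdf; apply: ge0_subset_integral => //.
- by apply/measurable_EFinP; exact: mpowphi.
- by move=> x _; rewrite lee_fin powphi_ge0.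
Qed.

(** The vanishing of the first moment, phrased with nonnegative integrands: the reflection
    [x |-> - x] preserves Lebesgue measure and [phi] and swaps the two parts. *)
Lemma integral_id_normal_pdf_pos_neg :
  (\int[mu]_x ((@id R)^\+ x * phi x)%:E = \int[mu]_x ((@id R)^\- x * phi x)%:E)%E.
Proof.
pose f x := ((@id R)^\- x * phi x)%:E.
have mf : measurable_fun setT f.
  apply/measurable_EFinP; apply: measurable_funM; last exact: measurable_normal_pdf.
  by apply: measurable_funrneg; exact: measurable_id.
transitivity (\int[pushforward mu (-%R : _ -> measurableTypeR R)]_x f x)%E.
  rewrite ge0_integral_pushforward//=.
    rewrite preimage_setT; apply: eq_integral => x _.
    by rewrite /f/= phiN /funrpos /funrneg opprK.
  by move=> x _; rewrite /f lee_fin mulr_ge0.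
by apply: eq_measure_integral => //= A mA AS; exact: lebesgue_measureN.
Qed.

End gaussian_moments.

(** * Moments of order at most four of a normal random variable *)

Section normal_random_variable.
Context d (T : measurableType d) (R : realType) (P : probability T R).
Context (X : {RV P >-> R}) (s : R).
Hypothesis s_gt0 : 0 < s.
Hypothesis distX : forall B : set R, measurable B ->
  distribution P X B = normal_prob 0 s B.
Local Notation mu := (@lebesgue_measure R).

Lemma ge0_integral_normal_RV (f : R -> R) : measurable_fun setT f ->
  (forall x, 0 <= f x) ->
  (\int[P]_t (f (X t))%:E = \int[mu]_x (f x * normal_pdf 0 s x)%:E)%E.
Proof.
move=> mf f0.
have mf' : measurable_fun [set: R] (EFin \o f) by exact/measurable_EFinP.
rewrite -(@ge0_integral_distribution _ _ _ _ _ P X (EFin \o f) mf' (fun y => f0 y)).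
(* [R] and [measurableTypeR R] have the same measurable sets but distinct
   displays, hence the explicit identity map. *)
have mid : measurable_fun setT (id : measurableTypeR R -> R).
  by move=> _ B mB; rewrite setTI.
have := @ge0_integral_weighted_pushforward _ _ (measurableTypeR R) _ R mu
  (distribution P X) id (normal_pdf 0 s) (EFin \o f) mf' mid
  (measurable_normal_pdf 0 s) (normal_pdf_ge0 0 s)
  (fun B mB => esym (distX mB)) (fun y => f0 y).
by move=> <-; apply: eq_integral => x _; rewrite -EFinM mulrC.
Qed.

Let mpow k : measurable_fun setT (fun x : R => x ^+ k).
Proof. by apply: continuous_measurable_fun; exact: exprn_continuous. Qed.

Let mXpow k : measurable_fun setT (fun t => X t ^+ k).
Proof. exact: (measurableT_comp (mpow k)). Qed.

Let int4 : P.-integrable setT (fun t => (X t ^+ 4)%:E).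
Proof.
apply/integrableP; split; first exact/measurable_EFinP.
under eq_integral do rewrite /= ger0_norm ?exprn_even_ge0//.
rewrite (@ge0_integral_normal_RV (fun x => x ^+ 4))//.
  exact: le_lt_trans (integral_pow4_normal_pdf s_gt0) (ltry _).
by move=> x; rewrite exprn_even_ge0.
Qed.

Let int_pow k : (k <= 4)%N -> P.-integrable setT (fun t => (X t ^+ k)%:E).
Proof.
move=> k4.
(* Domination: for [k <= 4], [|x| ^+ k] is at most 1 if [|x| <= 1] and at most [x ^+ 4]
   otherwise. *)
have int14 : P.-integrable setT (fun t => (1 + X t ^+ 4)%:E).
  by have [] := has_meanD (has_mean_cst P 1) (integrable_has_mean int4).
apply: le_integrable int14 => //; first exact/measurable_EFinP.
move=> t _; rewrite lee_fin normrX [leRHS]ger0_norm; last first.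
  by rewrite addr_ge0// exprn_even_ge0.
rewrite -(@ger0_norm _ (X t ^+ 4)) ?exprn_even_ge0// normrX.
have [x1|x1] := lerP `|X t| 1.
  by rewrite (@le_trans _ _ 1) ?exprn_ile1// lerDl exprn_ge0.
by rewrite (le_trans (ler_weXn2l (ltW x1) k4))// lerDr.
Qed.

(** The third moment is left without a value: in a monomial of degree four, a cube comes with a
    factor of exponent one, whose mean is zero. *)
Lemma normal_RV_moments : exists e : nat -> R,
  [/\ forall k, (k <= 4)%N -> has_mean P (fun t => X t ^+ k) (e k),
      e 0%N = 1, e 1%N = 0, e 2%N = s ^+ 2 & e 4%N <= 3 * s ^+ 4].
Proof.
exists (fun k => fine (\int[P]_t (X t ^+ k)%:E)%E).
have mean k : (k <= 4)%N ->
    has_mean P (fun t => X t ^+ k) (fine (\int[P]_t (X t ^+ k)%:E)%E).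
  by move=> k4; exact: integrable_has_mean (int_pow k4).
split=> //.
- exact: has_mean_unique (mean 0%N isT) (has_mean_cst P 1).
- have hp := integrable_has_mean (integrable_funrpos measurableT (int_pow (isT : (1 <= 4)%N))).
  have hn := integrable_has_mean (integrable_funrneg measurableT (int_pow (isT : (1 <= 4)%N))).
  have pn : (\int[P]_t ((@id R)^\+ (X t))%:E = \int[P]_t ((@id R)^\- (X t))%:E)%E.
    rewrite !ge0_integral_normal_RV//.
    - exact: integral_id_normal_pdf_pos_neg.
    - by apply: measurable_funrneg; exact: measurable_id.
    - by apply: measurable_funrpos; exact: measurable_id.
  apply: has_mean_unique (mean 1%N isT) _.
  rewrite -[X in has_mean _ _ X](subrr (fine (\int[P]_t ((@id R)^\- (X t))%:E)%E)).
  rewrite -{1}pn; apply: eq_has_mean (has_meanB hp hn) => t.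
  by rewrite -[RHS](congr1 (fun f => f t) (funrposBneg (fun t => X t ^+ 1))).
- have [_ h] := mean 2%N isT; apply: EFin_inj; rewrite -h.
  rewrite (@ge0_integral_normal_RV (fun x => x ^+ 2))//.
    exact: integral_sqr_normal_pdf.
  by move=> x; rewrite exprn_even_ge0.
- have [_ h] := mean 4%N isT; rewrite -lee_fin -h.
  rewrite (@ge0_integral_normal_RV (fun x => x ^+ 4))//.
    exact: integral_pow4_normal_pdf.
  by move=> x; rewrite exprn_even_ge0.
Qed.

End normal_random_variable.

(** * Moments of the Gram matrix *)

(** Monomials are encoded as lists of indices; grouping equal indices leaves one function per
    variable, the form in which independence applies. *)
Lemma big_seq_count_exp (R : comPzRingType) (I : finType) (x : I -> R) (l : seq I) :
  \prod_(i <- l) x i = \prod_i x i ^+ count_mem i l.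
Proof.
elim: l => [|j l IH]; first by rewrite big_nil big1.
rewrite big_cons IH (bigD1 j)//= [in RHS](bigD1 j)//= eqxx exprS mulrA.
congr (_ * _); apply: eq_bigr => i ij.
by rewrite eq_sym (negbTE ij).
Qed.

(** * Means of monomials of degree at most four in i.i.d. normal variables *)

Section iid_normal_moments.
Context d (T : measurableType d) (R : realType) (P : probability T R).
Context (I : finType) (a : I -> {RV P >-> R}) (v : R).
Hypothesis v_gt0 : 0 < v.
Hypothesis a_iid : iid_normal a 0 v.

Let s := Num.sqrt v.
Let s_gt0 : 0 < s. Proof. by rewrite sqrtr_gt0. Qed.
Let s2 : s ^+ 2 = v. Proof. by rewrite sqr_sqrtr// ltW. Qed.
Let s4 : s ^+ 4 = v ^+ 2. Proof. by rewrite (exprM s 2 2) s2. Qed.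

Let moments : exists e : I -> nat -> R, forall i,
  [/\ forall k, (k <= 4)%N -> has_mean P (fun t => a i t ^+ k) (e i k),
      e i 0%N = 1, e i 1%N = 0, e i 2%N = v & e i 4%N <= 3 * v ^+ 2].
Proof.
have /choice[e he] : forall i, exists e : nat -> R,
    [/\ forall k, (k <= 4)%N -> has_mean P (fun t => a i t ^+ k) (e k),
      e 0%N = 1, e 1%N = 0, e 2%N = v & e 4%N <= 3 * v ^+ 2].
  move=> i; rewrite -s4 -s2.
  exact: (normal_RV_moments s_gt0 (fun B mB => (proj1 a_iid) i B mB)).
by exists e.
Qed.

Let has_mean_monomial : exists e : I -> nat -> R,
  (forall l : seq I, (size l <= 4)%N ->
    has_mean P (fun t => \prod_(i <- l) a i t) (\prod_i e i (count_mem i l))) /\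
  (forall i, [/\ e i 0%N = 1, e i 1%N = 0, e i 2%N = v & e i 4%N <= 3 * v ^+ 2]).
Proof.
have [e he] := moments; exists e; split=> [l l4|i]; last by have [] := he i.
have indep := proj2 a_iid.
apply: eq_has_mean (independent_has_mean_prod indep (F := fun i x => x ^+ count_mem i l)
    (e := fun i => e i (count_mem i l)) _ _) => [t|i|i].
- by rewrite [RHS]big_seq_count_exp.
- by apply: continuous_measurable_fun; exact: exprn_continuous.
- have [h _ _ _ _] := he i; apply: h.
  exact: leq_trans (count_size _ _) l4.
Qed.

(** The variable of multiplicity one contributes its own mean, zero, as a factor. *)
Lemma iid_normal_mean_lone (l : seq I) i : (size l <= 4)%N -> count_mem i l = 1%N ->
  has_mean P (fun t => \prod_(j <- l) a j t) 0.
Proof.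
have [e [he e0]] := has_mean_monomial => /he h il.
have [_ e1 _ _] := e0 i.
by move: h; rewrite (bigD1 i)//= il e1 mul0r.
Qed.

Lemma iid_normal_mean_sqr i : has_mean P (fun t => a i t ^+ 2) v.
Proof.
have [e he] := moments; have [h _ _ <- _] := he i.
exact: h.
Qed.

Lemma iid_normal_mean_pow4 i :
  exists2 e, has_mean P (fun t => a i t ^+ 4) e & e <= 3 * v ^+ 2.
Proof.
have [e he] := moments; have [h _ _ _ e4] := he i.
by exists (e i 4%N) => //; exact: h.
Qed.

Lemma iid_normal_mean_sqr_sqr i j : i != j ->
  has_mean P (fun t => a i t ^+ 2 * a j t ^+ 2) (v ^+ 2).
Proof.
move=> ij; have [e [he e0]] := has_mean_monomial.
have /= h := he [:: i; i; j; j] isT.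
have ji : (j == i) = false by rewrite eq_sym (negbTE ij).
suff h2 : has_mean P (fun t => \prod_(k <- [:: i; i; j; j]) a k t) (v ^+ 2).
  by apply: eq_has_mean h2 => t; rewrite !big_cons big_nil; ring.
move: h; rewrite (bigD1 i)//= (bigD1 j)/=; last by rewrite eq_sym.
rewrite big1 => [|k /andP[ki kj]]; last first.
  rewrite eq_sym (negbTE ki) eq_sym (negbTE kj).
  by have [] := e0 k.
rewrite !eqxx ji (negbTE ij) /=.
have [_ _ -> _] := e0 i; have [_ _ -> _] := e0 j.
by rewrite mulr1 expr2.
Qed.

End iid_normal_moments.

(** * Mean and mean square of [A^T A u] *)

Section gram.
Context d (T : measurableType d) (R : realType) (P : probability T R).

(** A bound replaces the value because the fourth moment is only known up to an inequality;
    integrability is retained. *)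
Definition has_mean_le (f : T -> R) (b : R) : Prop :=
  exists2 e, has_mean P f e & e <= b.

Lemma has_mean_le_sum (J : finType) (f : J -> T -> R) (b : J -> R) :
  (forall i, has_mean_le (f i) (b i)) ->
  has_mean_le (fun t => \sum_i f i t) (\sum_i b i).
Proof.
move=> h; have /choice[e he] : forall i, exists e, has_mean P (f i) e /\ e <= b i.
  by move=> i; have [e] := h i; exists e.
exists (\sum_i e i); first by apply: has_mean_sum => i _; exact: (he i).1.
by apply: ler_sum => i _; exact: (he i).2.
Qed.

Lemma eq_has_mean_le f g b : f =1 g -> has_mean_le f b -> has_mean_le g b.
Proof. by move=> /funext ->. Qed.

Context (m n : nat) (a : 'I_m * 'I_n -> {RV P >-> R}) (v : R).
Hypothesis v_gt0 : 0 < v.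
Hypothesis a_iid : iid_normal a 0 v.
Variable u : 'cV[R]_n.
Local Notation A := (random_mx a).

Lemma gramE t i : ((A t)^T *m (A t *m u)) i 0 =
  \sum_k \sum_l u l 0 * (a (k, i) t * a (k, l) t).
Proof.
rewrite mxE; apply: eq_bigr => k _; rewrite !mxE mulr_sumr.
by apply: eq_bigr => l _; rewrite !mxE; ring.
Qed.

(** Only the terms with [l = i] survive, each with mean [v]. For [v = 1 / m] the mean is [u i 0]. *)
Lemma has_mean_gram i :
  has_mean P (fun t => ((A t)^T *m (A t *m u)) i 0) (m%:R * v * u i 0).
Proof.
rewrite (_ : m%:R * v * u i 0 =
    \sum_(k < m) \sum_(l < n) u l 0 * (if l == i then v else 0)); last first.
  under eq_bigr => k _.
    rewrite (bigD1 i)//= eqxx big1 ?addr0; last first.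
      by move=> l /negbTE ->; rewrite mulr0.
    over.
  by rewrite sumr_const card_ord -mulr_natl; ring.
apply: eq_has_mean (_ : has_mean P _ _); first by move=> t; rewrite gramE.
apply: has_mean_sum => k _; apply: has_mean_sum => l _; apply: has_meanZ.
have [->|li] := eqVneq l i.
  exact: eq_has_mean (iid_normal_mean_sqr v_gt0 a_iid (k, i)).
apply: eq_has_mean (iid_normal_mean_lone v_gt0 a_iid (l := [:: (k, i); (k, l)])
  (i := (k, l)) _ _) => [t||].
- by rewrite !big_cons big_nil mulr1.
- by [].
- by rewrite /= !xpair_eqE !eqxx/= eq_sym (negbTE li).
Qed.

(** This is the Wick formula: each summand of the bracket is one pairing of the four factors, namely
    first with second, first with third, first with fourth. All three pairings force [l' = l]. *)
Let quartic_mean_le k k' j l l' :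
  has_mean_le (fun t => u l 0 * u l' 0 *
      (a (k, j) t * a (k, l) t * (a (k', j) t * a (k', l') t)))
    (if l' == l then u l 0 ^+ 2 * (v ^+ 2 *
       ((l == j)%:R + (k == k')%:R + (k == k')%:R * (l == j)%:R)) else 0).
Proof.
set f := fun t => _.
have lone p : count_mem p [:: (k, j); (k, l); (k', j); (k', l')] = 1%N ->
    has_mean P f 0.
  move=> cp; rewrite -(mulr0 (u l 0 * u l' 0)).
  apply: eq_has_mean (has_meanZ (u l 0 * u l' 0)
    (iid_normal_mean_lone v_gt0 a_iid _ cp)) => // t.
  by rewrite /f !big_cons big_nil; ring.
(* If [l' != l], some entry occurs exactly once: [(k, l)] when [l != j], and [(k', l')] when
   [l = j]. *)
have [l'l|l'l] := eqVneq l' l; last first.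
  exists 0 => //.
  have [lj|lj] := eqVneq l j; last first.
    apply: (lone (k, l)); rewrite /= !xpair_eqE !eqxx/=.
    by rewrite (eq_sym j) (negbTE lj) (negbTE l'l) !andbF.
  apply: (lone (k', l')); rewrite /= !xpair_eqE !eqxx/=.
  by rewrite -lj (eq_sym l) (negbTE l'l) !andbF.
have scale (c e : R) (h : T -> R) :
    (forall t, f t = u l 0 ^+ 2 * h t) -> has_mean P h e -> e <= c ->
    has_mean_le f (u l 0 ^+ 2 * c).
  move=> fh he ec; exists (u l 0 ^+ 2 * e); last by rewrite ler_wpM2l// sqr_ge0.
  by apply: eq_has_mean (has_meanZ _ he) => t.
(* The bracket equals 3, 1, 1 and 0 in the four cases: a fourth power, two products of distinct
   squares, and a monomial with a lone entry. *)
have [lj|lj] := eqVneq l j; have [kk'|kk'] := eqVneq k k'.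
- have [e he e4] := iid_normal_mean_pow4 v_gt0 a_iid (k, j).
  apply: scale he _; last by move: e4 => /=; lra.
  by move=> t; rewrite /f l'l lj -kk'; ring.
- apply: (scale _ _ (fun t => a (k, j) t ^+ 2 * a (k', j) t ^+ 2)).
  + by move=> t; rewrite /f l'l lj; ring.
  + apply: (iid_normal_mean_sqr_sqr v_gt0 a_iid).
    by rewrite xpair_eqE (negbTE kk').
  + by rewrite /=; lra.
- apply: (scale _ _ (fun t => a (k, j) t ^+ 2 * a (k, l) t ^+ 2)).
  + by move=> t; rewrite /f l'l -kk'; ring.
  + apply: (iid_normal_mean_sqr_sqr v_gt0 a_iid).
    by rewrite xpair_eqE eqxx/= eq_sym.
  + by rewrite /=; lra.
- exists 0; last by rewrite /= mulr_ge0 ?sqr_ge0//; lra.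
  apply: (lone (k, l)); rewrite /= l'l !xpair_eqE !eqxx/=.
  by rewrite (eq_sym j) (negbTE lj) (eq_sym k') (negbTE kk').
Qed.

(** Summed over all indices, the three pairings contribute [m ^ 2], [m * n] and [m] times
    [v ^+ 2 * N], with [N] the squared norm of [u]. *)
Lemma has_mean_le_gram_sqr :
  has_mean_le (fun t => \sum_j (((A t)^T *m (A t *m u)) j 0) ^+ 2)
    (m%:R * (m + n + 1)%:R * v ^+ 2 * \sum_i u i 0 ^+ 2).
Proof.
set N := \sum_i u i 0 ^+ 2.
have -> : m%:R * (m + n + 1)%:R * v ^+ 2 * N =
    \sum_(j < n) \sum_(k < m) \sum_(k' < m) \sum_(l < n) \sum_(l' < n)
      (if l' == l then u l 0 ^+ 2 * (v ^+ 2 *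
       ((l == j)%:R + (k == k')%:R + (k == k')%:R * (l == j)%:R)) else 0).
  under eq_bigr => j _.
    under eq_bigr => k _.
      under eq_bigr => k' _.
        under eq_bigr => l _ do rewrite -big_mkcond big_pred1_eq.
        rewrite (_ : \sum_l _ = v ^+ 2 *
            (u j 0 ^+ 2 + (k == k')%:R * (N + u j 0 ^+ 2))); last first.
          rewrite /N (bigD1 j)//= [X in _ = _ * (_ + _ * (X + _))](bigD1 j)//=.
          rewrite eqxx.
          under eq_bigr => l /negbTE -> do rewrite add0r mulr0 addr0.
          rewrite -mulr_suml mulr1n; ring.
        over.
      rewrite -mulr_sumr big_split/= sumr_const card_ord.
      rewrite -mulr_suml (_ : \sum_(i < m) (k == i)%:R = 1); last first.
        rewrite (bigD1 k)//= eqxx big1 ?addr0// => i.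
        by rewrite eq_sym => /negbTE ->.
      over.
    rewrite sumr_const card_ord.
    over.
  rewrite /=; transitivity (\sum_(j < n)
      ((m%:R + 1) * m%:R * v ^+ 2 * u j 0 ^+ 2 + m%:R * v ^+ 2 * N)).
    rewrite big_split/= sumr_const card_ord -mulr_sumr -/N -mulr_natl !natrD.
    by ring.
  by apply: eq_bigr => j _; ring.
have sq t j : (((A t)^T *m (A t *m u)) j 0) ^+ 2 =
    \sum_k \sum_k' \sum_l \sum_l' u l 0 * u l' 0 *
      (a (k, j) t * a (k, l) t * (a (k', j) t * a (k', l') t)).
  rewrite gramE expr2 mulr_suml; apply: eq_bigr => k _.
  rewrite mulr_sumr; apply: eq_bigr => k' _.
  rewrite mulr_suml; apply: eq_bigr => l _.
  by rewrite mulr_sumr; apply: eq_bigr => l' _; ring.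
apply: (eq_has_mean_le (fun t => esym (eq_bigr _ (fun j _ => sq t j)))).
do 5 (apply: has_mean_le_sum => ?).
exact: quartic_mean_le.
Qed.

End gram.

(** * Look ahead thresholding for a fixed matrix *)

Section look_ahead.
Context (R : realType).

Lemma l2norm_sqr n (u : 'cV[R]_n) : l2norm u ^+ 2 = \sum_i u i 0 ^+ 2.
Proof. by rewrite sqr_sqrtr// sumr_ge0// => i _; exact: sqr_ge0. Qed.

Lemma derive_quadratic (V : normedModType R) (f : V -> R) (x v : V) (b c : R) :
  (forall h : R, f (h *: v + x) = f x + h * b + h ^+ 2 * c) -> 'D_v f x = b.
Proof.
move=> fE; apply/cvg_lim => //.
have hid : (h : R) @[h --> (0 : R)^'] --> (0 : R) by exact: nbhs_dnbhs.
have bc : b + h * c @[h --> (0 : R)^'] --> b + 0 * c.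
  by apply: cvgD; [exact: cvg_cst|apply: cvgM => //; exact: cvg_cst].
rewrite mul0r addr0 in bc.
apply: cvg_trans bc; apply: near_eq_cvg; near=> h.
have h0 : h != 0 by near: h; exact: nbhs_dnbhs_neq.
by rewrite /= fE /GRing.scale/=; field.
Unshelve. all: by end_near. Qed.

Lemma pderiv_cost m d (A : 'M[R]_(m, d)) (x z : 'cV[R]_d) i :
  pderiv (cost A (A *m x)) i z = 2 * (A^T *m (A *m (z - x))) i 0.
Proof.
apply: (@derive_quadratic _ _ _ _ _ (\sum_k A k i ^+ 2)) => h.
rewrite /cost !l2norm_sqr [in RHS]mxE !mulr_sumr -!big_split/=.
apply: eq_bigr => k _.
rewrite mulmxDr -scalemxAr -colE mulmxBr !mxE; ring.
Qed.

(** Complete the square in each coordinate; the partial derivative of the cost is [2 * g i 0]. *)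
Lemma lookahead_funE m d (A : 'M[R]_(m, d)) (xstar z : 'cV[R]_d) (eta : R) :
  exists K, forall x, lookahead_fun (cost A (A *m xstar)) eta z x =
    K + \sum_i (x i 0 - (z i 0 - 2 * eta * (A^T *m (A *m (z - xstar))) i 0)) ^+ 2.
Proof.
set g := A^T *m _.
exists (cost A (A *m xstar) z - \sum_i (2 * eta * g i 0) ^+ 2) => x.
rewrite /lookahead_fun -addrA; congr (_ + _).
rewrite addrC -sumrB; apply: eq_bigr => i _.
have := pderiv_cost A xstar z i; rewrite -/g => ->; ring.
Qed.

(** This pads the support of [xstar] to exactly [s] indices, the size of the sets competing in the
    thresholding. *)
Lemma exists_subset_card (I : finType) (B : {set I}) s :
  (#|B| <= s <= #|I|)%N -> exists2 S : {set I}, B \subset S & #|S| = s.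
Proof.
move=> /andP[Bs sI].
elim: s Bs sI => [|s IH].
  by rewrite leqn0 => /eqP B0 _; exists B.
rewrite leq_eqVlt => /orP[/eqP Bs _|Bs sI]; first by exists B.
have [S BS Ss] := IH Bs (ltnW sI).
have : (0 < #|~: S|)%N by have := cardsC S; lia.
move=> /card_gt0P[i]; rewrite inE => iS.
exists (i |: S); first by rewrite subsetU// BS orbT.
by rewrite cardsU1 iS Ss.
Qed.

Lemma lookahead_error (s d m : nat) (A : 'M[R]_(m, d)) (z xstar : 'cV[R]_d)
    (eta : R) (H : 'cV[R]_d -> 'cV[R]_d) (S : {set 'I_d}) :
  is_lookahead_thresholding s (cost A (A *m xstar)) eta H ->
  #|S| = s -> (forall i, i \notin S -> xstar i 0 = 0) ->
  let u := z - xstar in let g := A^T *m (A *m u) in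
  l2norm (H z - xstar) ^+ 2 <=
  2 * (\sum_(i in ~: S) (u i 0 ^+ 2 - 4 * eta * (u i 0 * g i 0)) +
       \sum_i (u i 0 ^+ 2 - 4 * eta * (u i 0 * g i 0)) +
       8 * eta ^+ 2 * \sum_i g i 0 ^+ 2).
Proof.
move=> lookH cardS xS /=.
set u := z - xstar; set g := A^T *m (A *m u).
have [W [_ HE Hmin]] := lookH z.
have [K KE] := lookahead_funE A xstar z eta.
have := Hmin S cardS; rewrite !KE lerD2l -HE -/u -/g => {KE Hmin}.
set w := fun i => z i 0 - 2 * eta * g i 0 => HS.
apply: (@le_trans _ _ (2 * (\sum_i (coord_proj S z i 0 - w i) ^+ 2 +
    \sum_i (w i - xstar i 0) ^+ 2))); last first.
  rewrite ler_wpM2l// le_eqVlt; apply/orP; left; apply/eqP.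
  (* On [S] the first difference is [2 * eta * g]. Off [S], where [xstar] vanishes, it is
     [- (u - 2 * eta * g)]. The second is [u - 2 * eta * g] everywhere, so [4 * eta ^+ 2 * g ^+ 2]
     occurs twice in every coordinate. *)
  rewrite mulr_sumr [\sum_(i in _) _]big_mkcond -!big_split/=.
  apply: eq_bigr => i _; rewrite /w /u !mxE inE.
  by case: ifPn => [_|iS]/=; [ring|rewrite xS//; ring].
apply: (@le_trans _ _ (2 * (\sum_i (H z i 0 - w i) ^+ 2 +
    \sum_i (w i - xstar i 0) ^+ 2))); last by rewrite ler_wpM2l// lerD2r.
rewrite l2norm_sqr -big_split mulr_sumr; apply: ler_sum => i _.
(* The identity [2 * (p ^+ 2 + q ^+ 2) - (p + q) ^+ 2 = (p - q) ^+ 2], with [p + q] the error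
   coordinate. *)
rewrite !mxE /= -subr_ge0 (_ : _ - _ = (H z i 0 - w i - (w i - xstar i 0)) ^+ 2); last ring.
exact: sqr_ge0.
Qed.

(* No measurability is needed since the integral of a nonnegative function is
   the supremum over the simple functions below it; the thresholding error is
   not known to be measurable. *)
Lemma ge0_le_integralT d (T : measurableType d) (mu : {measure set T -> \bar R})
    (f g : T -> \bar R) :
  (forall x, 0 <= f x)%E -> (forall x, f x <= g x)%E ->
  (\int[mu]_x f x <= \int[mu]_x g x)%E.
Proof.
move=> f0 fg.
have g0 x : (0 <= g x)%E by exact: le_trans (f0 x) (fg x).
rewrite !ge0_integralTE//; apply: le_ereal_sup => _ [h hf <-].
by exists h => // x; exact: le_trans (hf x) (fg x).
Qed.

End look_ahead.

(* The bound on the expected error *)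
Local Close Scope classical_set_scope.

Theorem theorem4p7 (R : realType) (s d m : nat)
    (s_gt0 : (0 < s)%N) (le_sd : (s <= d)%N) (m_gt0 : (0 < m)%N)
    (z xstar : 'cV[R]_d) (sparse_xstar : sparse s xstar)
    (disp : measure_display) (T : measurableType disp) (P : probability T R)
    (a : 'I_m * 'I_d -> {RV P >-> R})
    (a_iid : iid_normal a 0 (1 / m%:R))
    (eta : R) (H : T -> 'cV[R]_d -> 'cV[R]_d)
    (H_lookahead : forall t : T,
       is_lookahead_thresholding s
         (cost (random_mx a t) (random_mx a t *m xstar)) eta (H t))
    (eta_gt0 : 0 < eta)
    (eta_lt : eta < 1 / 2 * (m%:R / (m + d + 1)%:R)) :
  exists rho : R, rho < 2 /\
    ('E_P[fun t : T => l2norm (H t z - xstar)]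
       <= (rho * l2norm (z - xstar))%:E)%E.
Proof.
have [S suppS cardS] : exists2 S : {set 'I_d},
    [set i | xstar i 0 != 0]%SET \subset S & #|S| = s.
  apply: exists_subset_card; rewrite card_ord le_sd andbT.
  by rewrite cardsE; exact: sparse_xstar.
have xS i : i \notin S -> xstar i 0 = 0.
  move=> iS; apply/eqP; apply: contraNT iS => xi.
  by apply: (fintype.subsetP suppS); rewrite inE.
set u := z - xstar; set N := \sum_i u i 0 ^+ 2.
pose g t := (random_mx a t)^T *m (random_mx a t *m u).
pose Q t := \sum_(i in ~: S) (u i 0 ^+ 2 - 4 * eta * (u i 0 * g t i 0)) +
  \sum_i (u i 0 ^+ 2 - 4 * eta * (u i 0 * g t i 0)) +
  8 * eta ^+ 2 * \sum_i g t i 0 ^+ 2.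
have errQ t : l2norm (H t z - xstar) ^+ 2 <= 2 * Q t.
  exact: (lookahead_error z (H_lookahead t) cardS xS).
have mR0 : 0 < m%:R :> R by rewrite ltr0n.
have v_gt0 : 0 < 1 / m%:R :> R by rewrite divr_gt0.
have [E gE] := has_mean_le_gram_sqr v_gt0 a_iid u; rewrite -/N => EN.
have mean_ug i : has_mean P (fun t => u i 0 ^+ 2 - 4 * eta * (u i 0 * g t i 0))
    ((1 - 4 * eta) * u i 0 ^+ 2).
  have h := has_mean_gram v_gt0 a_iid u i.
  have := has_meanB (has_mean_cst P (u i 0 ^+ 2))
    (has_meanZ (4 * eta) (has_meanZ (u i 0) h)).
  by congr (has_mean _ _ _); field; rewrite gt_eqF.
pose q := \sum_(i in ~: S) (1 - 4 * eta) * u i 0 ^+ 2 +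
  \sum_i (1 - 4 * eta) * u i 0 ^+ 2 + 8 * eta ^+ 2 * E.
have meanQ : has_mean P Q q.
  apply: has_meanD; last exact: has_meanZ.
  by apply: has_meanD; apply: has_mean_sum => i _; exact: mean_ug.
(* The case [z = xstar] is treated apart, since the general [rho] divides by [N]; here the error is
   identically zero. *)
have [N0|N0] := eqVneq N 0.
  exists 0; split=> //.
  have u0 : u = 0.
    apply/colP => i; rewrite [RHS]mxE; apply/eqP; rewrite -sqrf_eq0; apply/eqP.
    apply: (psumr_eq0P _ N0) => // j _; exact: sqr_ge0.
  have err0 t : l2norm (H t z - xstar) = 0.
    apply/eqP; rewrite -sqrf_eq0 eq_le sqr_ge0 andbT (le_trans (errQ t))//.
    have g0 : g t = 0 by rewrite /g u0 !mulmx0.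
    rewrite /Q g0 u0 !big1 ?mulr0 ?addr0// => i _;
      by rewrite !mxE ?mul0r ?mulr0 expr0n ?subrr.
  rewrite mul0r (_ : (fun t => _) = fun=> 0); last exact/funext.
  by rewrite expectation_cst.
have N_gt0 : 0 < N by rewrite lt_neqAle eq_sym N0 sumr_ge0// => i _; exact: sqr_ge0.
set c := l2norm u.
have cN : c ^+ 2 = N by rewrite l2norm_sqr.
have c_gt0 : 0 < c by rewrite lt_neqAle sqrtr_ge0 andbT eq_sym -sqrf_eq0 cN.
have q_lt : q < 2 * N.
  set M := \sum_(i in ~: S) u i 0 ^+ 2.
  have M0 : 0 <= M by apply: sumr_ge0 => i _; exact: sqr_ge0.
  have MN : M <= N.
    rewrite /N (bigID (mem (~: S)))/= lerDl.
    by apply: sumr_ge0 => i _; exact: sqr_ge0.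
  have k0 : 0 < (m + d + 1)%:R :> R by rewrite ltr0n addn1.
  have EN' : m%:R * E <= (m + d + 1)%:R * N.
    rewrite -(ler_pM2l v_gt0) (_ : 1 / m%:R * (m%:R * E) = E); last first.
      by field; rewrite gt_eqF.
    apply: le_trans EN _; rewrite le_eqVlt; apply/orP; left; apply/eqP.
    by field; rewrite gt_eqF.
  have eta_lt' : 2 * eta * (m + d + 1)%:R < m%:R.
    by move: eta_lt; rewrite mulrA ltr_pdivlMr// => h; lra.
  (* This is where the upper bound on [eta] enters, against [E <= (m + d + 1) / m * N]. *)
  have eE : eta * E < N / 2.
    rewrite -(ltr_pM2l mR0).
    have : eta * (m%:R * E) <= eta * ((m + d + 1)%:R * N) by rewrite ler_pM2l.
    have : (2 * eta * (m + d + 1)%:R) * N < m%:R * N by rewrite ltr_pM2r.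
    by lra.
  have eeE : 8 * eta ^+ 2 * E < 4 * eta * N.
    have : eta * (eta * E) < eta * (N / 2) by rewrite ltr_pM2l.
    by lra.
  rewrite /q -!mulr_sumr -/M -/N.
  (* Here [q = (1 - 4 * eta) * (M + N) + 8 * eta ^+ 2 * E]. If [1 - 4 * eta <= 0], dropping the [M]
     term already gives [q < N]; otherwise [M <= N] gives [q < 2 * N - 4 * eta * N]. *)
  have [h|h] := lerP (1 - 4 * eta) 0.
    have : (1 - 4 * eta) * M <= 0 by rewrite mulr_le0_ge0.
    by lra.
  have : (1 - 4 * eta) * M <= (1 - 4 * eta) * N by rewrite ler_pM2l.
  have : 0 < eta * N by rewrite mulr_gt0.
  by lra.
(* The mean of the bound [Q / (2 * c) + c], divided by [c]; it is below 2 because [q < 2 * N]. *)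
exists (q / (2 * N) + 1); split.
  by rewrite -ltrBrDr (_ : 2 - 1 = 1); [rewrite ltr_pdivrMr ?mul1r// mulr_gt0|ring].
(* A bound linear in [Q], so that only the mean of [Q] enters: [4 * c * l <= l ^+ 2 + 4 * c ^+ 2 <=
   2 * Q + 4 * c ^+ 2]. *)
have le_err t : l2norm (H t z - xstar) <= (2 * c)^-1 * Q t + c.
  have l0 : 0 <= l2norm (H t z - xstar) by exact: sqrtr_ge0.
  have := errQ t; set l := l2norm _ in l0 *; move=> lQ.
  rewrite -(ler_pM2l (_ : 0 < 2 * c)) ?mulr_gt0// mulrDr mulrA divff ?mul1r; last first.
    by rewrite gt_eqF// mulr_gt0.
  have : 0 <= (l - 2 * c) ^+ 2 by exact: sqr_ge0.
  by lra.
have [_ meanB] := has_meanD (has_meanZ (2 * c)^-1 meanQ) (has_mean_cst P c).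
rewrite unlock; apply: le_trans (ge0_le_integralT P
  (g := fun t => ((2 * c)^-1 * Q t + c)%:E) _ _) _.
- by move=> t; rewrite lee_fin sqrtr_ge0.
- by move=> t; rewrite lee_fin.
- rewrite meanB lee_fin -cN le_eqVlt; apply/orP; left; apply/eqP.
  by field; rewrite gt_eqF.
Qed.
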